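(* Let $X$ be a uniformly discrete bounded geometry metric space for which $\kappa_X(R)>1$ for some $R>0$. Then $X$ does not admit an injective uniform embedding into any countable group.
   Context: Countable groups are regarded as discrete and are equipped with a proper left-invariant metric (unique up to coarse equivalence). A map $\phi\colon X\to Y$ of metric spaces is a uniform embedding if for all $R$ there exists $S$ such that $d(x,y)\le R$ implies $d(\phi(x),\phi(y))\le S$, and for all $R$ there exists $S$ such that $d(\phi(x),\phi(y))\le R$ implies $d(x,y)\le S$. Let $(X,d)$ be a metric space. $X$ is uniformly discrete if there is $c>0$ with $d(x,y)\ge c$ for all distinct $x,y$; it has bounded geometry if for every $R>0$ there is $N$ such that every ball $B_R(x)$ has at most $N$ points. A partial bijection of $X$ is a subset $s\subseteq X\times X$ on which both coordinate projections to $X$ are injective; it is viewed as a partially defined injection, writing $x=s(y)$ (or $x=sy$) if $(x,y)\in s$. A partial translation of $X$ is a partial bijection $t$ such that $d(x,y)$ is bounded for $(x,y)\in t$. If $\mathcal{T}$ is a collection of (pairwise) disjoint partial translations of $X$, a partial bijection $\sigma$ is a partial cotranslation for $\mathcal{T}$ if for all $t\in\mathcal{T}$ and $(x,y)\in t$ such that $\sigma$ is defined on both $x$ and $y$, we have $(\sigma x,\sigma y)\in t$. An atlas on $X$ is a family $\mathcal{A}=\{(\mathcal{T}_R,\Sigma_R)\mid R>0\}$ where, for each $R>0$, $\mathcal{T}_R$ is a finite set of disjoint partial translations of $X$ and $\Sigma_R$ is a collection of partial cotranslations for $\mathcal{T}_R$ such that: (1) the union of the $t\in\mathcal{T}_R$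 contains all $(x,y)\in X\times X$ with $d(x,y)<R$; (2) there exists $k$ such that for each $x,x'\in X$ there are at most $k$ elements $\sigma\in\Sigma_R$ with $\sigma x=x'$; (3) for each $t\in\mathcal{T}_R$ and all $(x,y),(x',y')\in t$ there exists $\sigma\in\Sigma_R$ with $\sigma x=x'$ and $\sigma y=y'$. Let $k_{\mathcal{A}}(R)$ be the smallest $k$ for which (2) holds. For $X$ uniformly discrete of bounded geometry (such spaces always admit an atlas), $\kappa_X(R)$ is the minimum of $k_{\mathcal{A}}(R)$ over all atlases $\mathcal{A}$ on $X$. *)

(* Defs.v *)
From HB Require Import structures.
From mathcomp Require Import all_boot all_order all_algebra.
From mathcomp Require Import all_classical all_reals all_analysis.

Set Implicit Arguments.
Unset Strict Implicit.
Unset Printing Implicit Defensive.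

Import Order.TTheory GRing.Theory Num.Theory.

Local Open Scope classical_set_scope.
Local Open Scope ring_scope.
Local Open Scope card_scope.

#[short(type="metricGroupType")]
HB.structure Definition MetricGroup (R : numDomainType) :=
  { G of Group G & Metric R G }.

Section MetricSpaces.
Context {R : realType}.

Definition uniformly_discrete (X : metricType R) : Prop :=
  exists2 c : R, 0 < c & forall x y : X, x <> y -> c <= mdist x y.

Definition bounded_geometry (X : metricType R) : Prop :=
  forall r : R, 0 < r -> exists N : nat, forall x : X, ball x r #<= `I_N.

Definition uniform_embedding (X Y : metricType R) (phi : X -> Y) : Prop :=
  (forall r : R, exists s : R, forall x y : X,
     mdist x y <= r -> mdist (phi x) (phi y) <= s) /\
  (forall r : R, exists s : R, forall x y : X,
     mdist (phi x) (phi y) <= r -> mdist x y <= s).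

Definition proper_metric (X : metricType R) : Prop :=
  forall (x : X) (r : R), compact [set y : X | mdist x y <= r].

Definition discrete_topological_space (T : topologicalType) : Prop :=
  forall x : T, open [set x].

Definition left_invariant_metric (G : metricGroupType R) : Prop :=
  forall g x y : G, mdist (g * x)%g (g * y)%g = mdist x y.

End MetricSpaces.

Section Atlases.
Context {R : realType} (X : metricType R).

(* A pair (x, y) in s is read as x = s(y): the value is the first component,
   the argument the second. *)
Definition partial_bijection (s : set (X * X)) : Prop :=
  set_inj s fst /\ set_inj s snd.

Definition partial_translation (t : set (X * X)) : Prop :=
  partial_bijection t /\
  exists M : R, forall x y : X, t (x, y) -> mdist x y <= M.

Definition partial_cotranslation (T : set (set (X * X))) (s : set (X * X))
    : Prop :=
  partial_bijection s /\
  forall t, T t -> forall x y x' y' : X,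
    t (x, y) -> s (x', x) -> s (y', y) -> t (x', y').

Definition multiplicity_bound (S : set (set (X * X))) (k : nat) : Prop :=
  forall x x' : X, [set s | S s /\ s (x', x)] #<= `I_k.

(* The values of the two families at r <= 0 are irrelevant. *)
Record atlas : Type := Atlas {
  translations : R -> set (set (X * X)) ;
  cotranslations : R -> set (set (X * X)) ;
  atlas_finite : forall r, 0 < r -> finite_set (translations r) ;
  atlas_translation : forall r, 0 < r ->
    translations r `<=` partial_translation ;
  atlas_disjoint : forall r, 0 < r -> trivIset (translations r) id ;
  atlas_cotranslation : forall r, 0 < r ->
    cotranslations r `<=` partial_cotranslation (translations r) ;
  atlas_cover : forall r, 0 < r ->
    [set p : X * X | mdist p.1 p.2 < r] `<=` \bigcup_(t in translations r) t ;
  atlas_multiplicity : forall r, 0 < r ->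
    exists k, multiplicity_bound (cotranslations r) k ;
  atlas_transitive : forall r, 0 < r -> forall t, translations r t ->
    forall x y x' y' : X, t (x, y) -> t (x', y') ->
    exists s, [/\ cotranslations r s, s (x', x) & s (y', y)]
}.

(* The minimum of a set of naturals, 0 if the set is empty. *)
Definition least (P : set nat) : nat := xget 0%N (P `&` lbound P).

Definition atlas_k (A : atlas) (r : R) : nat :=
  least (multiplicity_bound (cotranslations A r)).

(* A uniformly discrete space of bounded geometry always has an atlas, so on
   such a space the minimum is taken over a nonempty set. *)
Definition kappa (r : R) : nat := least (range (fun A : atlas => atlas_k A r)).

End Atlases.

(* Main.v *)
Require Import Defs.
From HB Require Import structures.
From mathcomp Require Import all_boot all_order all_algebra.
From mathcomp Require Import all_classical all_reals all_analysis.

(** Right multiplications of a group commute with its left multiplications.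
    Given an injection [phi] of [X] into a group [G], right multiplication by
    [g] pulls back to the set of pairs [(x, y)] with [phi y = phi x * g], and
    left multiplication by [h] pulls back to a partial bijection of [X] which
    preserves all of these sets. Left multiplications act simply transitively:
    exactly one of them carries a given point to another. Hence a given pair
    of points of [X] belongs to a single partial cotranslation, and pairs with
    the same displacement [g] are exchanged by these cotranslations
    ([left_right_transitive]).

    Everything else only serves to see that these sets make up an atlas. If
    [phi] is a uniform embedding and the metric of [G] is left-invariant, then
    the points at distance at most [r] have displacements in some ball of [G]
    about the identity, and conversely a fixed displacement bounds the distance
    in [X]. Balls of a proper discrete space are finite ([compact_finite_set]),
    so finitely many displacements suffice for each [r]. The multiplicity of
    this atlas is at most one at every scale ([multiplicity_left_shifts]), so
    [kappa X r <= 1] for all [r > 0]. *)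

Import Order.TTheory GRing.Theory Num.Theory.

Local Open Scope classical_set_scope.
Local Open Scope ring_scope.
Local Open Scope card_scope.

(** Were the set infinite, the complements in it of its finite subsets would
    generate a proper filter; a cluster point [p] of it is impossible, because
    the neighbourhood [[set p]] misses the complement of [p]. *)
Lemma compact_finite_set (T : topologicalType) (A : set T) :
  discrete_topological_space T -> compact A -> finite_set A.
Proof.
move=> discT cA; apply: contrapT => infA.
pose F : set_system T := [set B | finite_set (A `\` B)].
have FF : ProperFilter F.
  split; first by rewrite /F /= setD0.
  split.
  - by rewrite /F /= setDT; exact: finite_set0.
  - by move=> P Q; rewrite /F => fP fQ; rewrite /= setDIr finite_setU.
  - by move=> P Q PQ; rewrite /F /=; apply: sub_finite_set; exact: setDS.
have FA : F A by rewrite /F /= setDv; exact: finite_set0.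
have [p [_ clp]] := cA F FF FA.
have Fp : F (~` [set p]).
  by apply: sub_finite_set (finite_set1 p) => x [_ /contrapT].
have [x [/= xp]] := clp _ _ Fp (open_nbhs_nbhs (conj (discT p) erefl)).
exact: xp.
Qed.

Lemma least_le (P : set nat) (n : nat) : P n -> (least P <= n)%N.
Proof.
by move=> Pn; rewrite /least; case: xgetP => [m _ [_ lbm]|//]; exact: lbm.
Qed.

Section EmbeddingIntoGroup.
Context {R : realType} {X : metricType R} {G : metricGroupType R}.
Variable phi : X -> G.

Definition right_shift (g : G) : set (X * X) :=
  [set p | phi p.2 = (phi p.1 * g)%g].

Definition left_shift (h : G) : set (X * X) :=
  [set p | phi p.1 = (h * phi p.2)%g].

Definition left_shifts : set (set (X * X)) := range left_shift.

(** The shift [h] can be recovered from a single pair [(x', x)]. *)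
Lemma multiplicity_left_shifts : multiplicity_bound left_shifts 1.
Proof.
move=> x x'; rewrite II1.
apply: (@card_le_trans _ _ _ [set left_shift (phi x' * (phi x)^-1)%g]).
  apply: subset_card_le => _ [[h _ <-]] /= e.
  by rewrite e mulgK.
by rewrite (card_le_eql (eq_card1 _ 0%N)).
Qed.

(** The element of [G] which takes [phi x] to [phi x'] on the left also takes
    [phi y = phi x * g] to [phi y' = phi x' * g], by associativity. *)
Lemma left_right_transitive (g : G) (x y x' y' : X) :
  right_shift g (x, y) -> right_shift g (x', y') ->
  exists s, [/\ left_shifts s, s (x', x) & s (y', y)].
Proof.
rewrite /right_shift /= => ey ey'.
exists (left_shift (phi x' * (phi x)^-1)%g); split.
- by exists (phi x' * (phi x)^-1)%g.
- by rewrite /left_shift /= mulgVK.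
- by rewrite /left_shift /= ey ey' mulgA mulgVK.
Qed.

Lemma right_shift_disjoint (g h : G) (p : X * X) :
  right_shift g p -> right_shift h p -> g = h.
Proof. by rewrite /right_shift /= => -> /mulgI. Qed.

Hypothesis phi_inj : injective phi.

Lemma right_shift_bijection (g : G) : partial_bijection (right_shift g).
Proof.
split=> -[x y] [x' y'] /set_mem /= e /set_mem /= e' /= E.
- by congr pair => //; apply: phi_inj; rewrite e e' E.
- by congr pair => //; apply: phi_inj; apply: (@mulIg _ g); rewrite -e -e' E.
Qed.

Lemma left_shift_bijection (h : G) : partial_bijection (left_shift h).
Proof.
split=> -[x y] [x' y'] /set_mem /= e /set_mem /= e' /= E.
- by congr pair => //; apply: phi_inj; apply: (@mulgI _ h); rewrite -e -e' E.
- by congr pair => //; apply: phi_inj; rewrite e e' E.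
Qed.

Lemma left_shift_cotranslation (D : set G) (h : G) :
  partial_cotranslation (right_shift @` D) (left_shift h).
Proof.
split; first exact: left_shift_bijection.
move=> _ [g _ <-] x y x' y'; rewrite /right_shift /left_shift /=.
by move=> -> -> ->; rewrite mulgA.
Qed.

Hypothesis Ginvariant : left_invariant_metric G.

Lemma mdist_right_shift (g : G) (x y : X) :
  right_shift g (x, y) -> mdist (phi x) (phi y) = mdist 1%g g.
Proof.
rewrite /right_shift /= => ->.
by rewrite -[X in mdist X _]mulg1 Ginvariant.
Qed.

Hypothesis Gdiscrete : discrete_topological_space G.
Hypothesis Gproper : proper_metric G.
Hypothesis phi_unif : uniform_embedding phi.

Lemma right_shift_translation (g : G) : partial_translation (right_shift g).
Proof.
split; first exact: right_shift_bijection.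
have [M hM] := phi_unif.2 (mdist 1%g g).
by exists M => x y /mdist_right_shift e; apply: hM; rewrite e.
Qed.

(** One family of cotranslations serves all scales: only the finite set of
    displacements, hence of right shifts, has to grow with [r]. *)
Lemma exists_multiplicity_one_atlas :
  exists A : atlas X, forall r : R, multiplicity_bound (cotranslations A r) 1.
Proof.
(* [rho r] bounds the displacements of pairs of points at distance at most [r],
   so the right shifts by the ball of radius [rho r] cover all these pairs. *)
have [rho hrho] := choice phi_unif.1.
pose D r : set G := [set g | mdist 1%g g <= rho r].
unshelve eexists (@Atlas R X (fun r => right_shift @` D r) (fun=> left_shifts)
  _ _ _ _ _ _ _) => r; last exact: multiplicity_left_shifts.
- by move=> _; apply: finite_image; exact: (compact_finite_set _ _ Gdiscrete (Gproper 1%g (rho r))).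
- by move=> _ _ [g _ <-]; exact: right_shift_translation.
- move=> _ _ _ [g _ <-] [h _ <-] [p [pg ph]].
  by rewrite (right_shift_disjoint _ _ _ pg ph).
- by move=> _ _ [h _ <-]; exact: left_shift_cotranslation.
- move=> _ [x y] /= xy.
  have xyg : right_shift ((phi x)^-1 * phi y)%g (x, y).
    by rewrite /right_shift /= mulVKg.
  exists (right_shift ((phi x)^-1 * phi y)%g) => //.
  exists ((phi x)^-1 * phi y)%g => //.
  by rewrite /D /= -(mdist_right_shift _ _ _ xyg); apply/hrho/ltW.
- by exists 1; exact: multiplicity_left_shifts.
- by move=> _ _ [g _ <-] x y x' y' xy; exact: (left_right_transitive g).
Qed.

Lemma kappa_le1 (r : R) : (kappa X r <= 1)%N.
Proof.
have [A hA] := exists_multiplicity_one_atlas.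
apply: (@leq_trans (atlas_k A r)); apply: least_le; last exact: hA.
by exists A.
Qed.

End EmbeddingIntoGroup.

Theorem corollary20 (R : realType) (X : metricType R)
    (Xdiscrete : uniformly_discrete X)
    (Xgeom : bounded_geometry X)
    (Xkappa : exists r : R, 0 < r /\ (1 < kappa X r)%N)
    (G : metricGroupType R)
    (Gcountable : countable [set: G])
    (Gdiscrete : discrete_topological_space G)
    (Gproper : proper_metric G)
    (Ginvariant : left_invariant_metric G) :
  ~ (exists phi : X -> G, injective phi /\ uniform_embedding phi).
Proof.
move=> [phi [phi_inj phi_unif]]; have [r [_]] := Xkappa.
by apply/negP; rewrite -leqNgt; exact: (kappa_le1 phi).
Qed.
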